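(* Let $m>0$, $K\in\mathbb{R}$ and $\alpha\in\mathbb{R}$ with $\alpha\ne 0$ and $\alpha\neq 2$. Consider the Lagrangian on $\mathbb{R}^3\times\mathbb{R}^3$ $$L(x,y,z,\dot x,\dot y,\dot z)=\tfrac12 m\left[\dot x^2+\dot y^2+\dot z^2-2(1-\alpha)\dot y\dot z\right]-\tfrac12K\left[x^2+y^2+z^2-2(1-\alpha)yz\right].$$ Then the map from velocities $(\dot x,\dot y,\dot z)$ to canonical momenta $(P_x,P_y,P_z)=\left(\frac{\partial L}{\partial\dot x},\frac{\partial L}{\partial\dot y},\frac{\partial L}{\partial\dot z}\right)$ is invertible, and the Hamiltonian $H=P_x\dot x+P_y\dot y+P_z\dot z-L$, expressed in terms of positions and momenta, is $$H=\frac{P_x^2}{2m}+\frac{P_y^2+P_z^2+2(1-\alpha)P_yP_z}{2m\left(1-(1-\alpha)^2\right)}+\frac12K\left[x^2+y^2+z^2-2(1-\alpha)yz\right].$$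
   Context: The Lagrangian is that of a harmonic oscillator whose kinetic and potential energies are built from the Trinition squared norm $\|(a,b,c)\|_\alpha^2=a^2+b^2+c^2-2(1-\alpha)bc$, i.e. $L=\frac12m\|(\dot x,\dot y,\dot z)\|_\alpha^2-\frac12K\|(x,y,z)\|_\alpha^2$. *)

(* Defs.v *)
From Stdlib Require Import Reals ssrfun.
From Coquelicot Require Import Coquelicot.
Open Scope R_scope.

Definition R3 : Type := (R * R * R)%type.

Definition dot (p v : R3) : R :=
  let '(px, py, pz) := p in
  let '(vx, vy, vz) := v in
  px * vx + py * vy + pz * vz.

Definition lagrangian (m K alpha : R) (q v : R3) : R :=
  let '(x, y, z) := q in
  let '(vx, vy, vz) := v in
  1 / 2 * m * (vx ^ 2 + vy ^ 2 + vz ^ 2 - 2 * (1 - alpha) * vy * vz)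
  - 1 / 2 * K * (x ^ 2 + y ^ 2 + z ^ 2 - 2 * (1 - alpha) * y * z).

(** The canonical momenta are the partial derivatives of [L] with respect to
    the velocities, at the fixed position [q]. *)
Definition momentum (L : R3 -> R3 -> R) (q v : R3) : R3 :=
  let '(vx, vy, vz) := v in
  (Derive (fun u => L q (u, vy, vz)) vx,
   Derive (fun u => L q (vx, u, vz)) vy,
   Derive (fun u => L q (vx, vy, u)) vz).

(** [V q] is meant to be the inverse of [momentum L q], so that the velocities
    are expressed through the momenta [p]. *)
Definition hamiltonian (L : R3 -> R3 -> R) (V : R3 -> R3 -> R3) (q p : R3) : R :=
  dot p (V q p) - L q (V q p).

(* Main.v *)
Require Import Defs.
From Stdlib Require Import Reals Lra ssrfun.
From Coquelicot Require Import Coquelicot.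
Open Scope R_scope.

(** The kinetic energy is a quadratic form in the velocities, so the momenta
    are a linear function of them: with [c = 1 - alpha],
    [P = (m vx, m (vy - c vz), m (vz - c vy))]
    ([momentum_lagrangian]).  The [y]-[z] block of this map has determinant
    [m ^ 2 * (1 - c ^ 2)], and [1 - c ^ 2 = alpha * (2 - alpha)] is nonzero
    exactly when [alpha] is neither [0] nor [2] ([mass_det_neq0]).  Hence the
    map can be inverted by Cramer's rule ([velocity]), and substituting the
    inverse into [P . v - L] gives the Hamiltonian. *)

Lemma mass_det_neq0 (alpha : R) :
  alpha <> 0 -> alpha <> 2 -> 1 - (1 - alpha) ^ 2 <> 0.
Proof.
  intros h0 h2.
  replace (1 - (1 - alpha) ^ 2) with (alpha * (2 - alpha)) by ring.
  apply Rmult_integral_contrapositive_currified; lra.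
Qed.

Lemma momentum_lagrangian (m K alpha : R) (q : R3) (vx vy vz : R) :
  momentum (lagrangian m K alpha) q (vx, vy, vz) =
  (m * vx, m * (vy - (1 - alpha) * vz), m * (vz - (1 - alpha) * vy)).
Proof.
  destruct q as [[x y] z]; unfold momentum, lagrangian.
  f_equal; [f_equal|]; apply is_derive_unique; auto_derive; trivial; field.
Qed.

(** Cramer's rule for the linear system of [momentum_lagrangian]. *)
Definition velocity (m alpha : R) (p : R3) : R3 :=
  let '(px, py, pz) := p in
  let d := m * (1 - (1 - alpha) ^ 2) in
  (px / m, (py + (1 - alpha) * pz) / d, (pz + (1 - alpha) * py) / d).

Theorem mainTheorem7 (m K alpha : R) (hm : 0 < m)
    (halpha0 : alpha <> 0) (halpha2 : alpha <> 2) :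
  exists V : R3 -> R3 -> R3,
    (forall q : R3,
        cancel (momentum (lagrangian m K alpha) q) (V q) /\
        cancel (V q) (momentum (lagrangian m K alpha) q)) /\
    (forall x y z Px Py Pz : R,
        hamiltonian (lagrangian m K alpha) V (x, y, z) (Px, Py, Pz) =
        Px ^ 2 / (2 * m)
        + (Py ^ 2 + Pz ^ 2 + 2 * (1 - alpha) * Py * Pz)
          / (2 * m * (1 - (1 - alpha) ^ 2))
        + 1 / 2 * K * (x ^ 2 + y ^ 2 + z ^ 2 - 2 * (1 - alpha) * y * z)).
Proof.
  assert (hm0 : m <> 0) by lra.
  pose proof (mass_det_neq0 alpha halpha0 halpha2) as hd.
  exists (fun _ => velocity m alpha); split.
  - intros q; split.
    + intros [[vx vy] vz]; rewrite momentum_lagrangian; unfold velocity.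
      f_equal; [f_equal|]; field; auto.
    + intros [[px py] pz]; unfold velocity; rewrite momentum_lagrangian.
      f_equal; [f_equal|]; field; auto.
  - intros x y z Px Py Pz; unfold hamiltonian, velocity, dot, lagrangian.
    field; auto.
Qed.
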